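(* Let $n\ge 4$ be an even integer and let $\mathscr{A}$ and $\mathscr{B}$ be two antichains of $\mathbb{N}_n$. Suppose that for some integer $k\le\min\{|\mathscr{A}|,|\mathscr{B}|\}$ the members can be enumerated as $\mathscr{A}=\{A_1,A_2,\dots\}$, $\mathscr{B}=\{B_1,B_2,\dots\}$ so that for all $A_i\in\mathscr{A}$, $B_j\in\mathscr{B}$, $A_i\cap B_j=\emptyset$ only if $i=j\le k$. If $$|\mathscr{A}|+|\mathscr{B}|=\binom{n}{n/2}+\binom{n}{n/2+1}-\kappa^*_{n/2}(k),$$ then for each $\mathscr{X}\in\{\mathscr{A},\mathscr{B}\}$: (i) $\mathscr{X}\subseteq\binom{\mathbb{N}_n}{n/2}\cup\binom{\mathbb{N}_n}{n/2+1}$; (ii) $\mathscr{X}=\mathscr{X}^{(n/2)}\cup\Big(\binom{\mathbb{N}_n}{n/2+1}\setminus\nabla\mathscr{X}^{(n/2)}\Big)$; (iii) $|\nabla\mathscr{X}^{(n/2)}|=|\nabla L_{n,n/2}(|\mathscr{X}^{(n/2)}|)|$.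
   Context: An antichain of $\mathbb{N}_n=\{1,\dots,n\}$ is a family of subsets no member of which is contained in another. $\binom{\mathbb{N}_n}{r}$ denotes the family of all $r$-subsets of $\mathbb{N}_n$, and $\mathscr{X}^{(r)}=\mathscr{X}\cap\binom{\mathbb{N}_n}{r}$. For a family $\mathscr{F}$ of $r$-sets, its shade is $\nabla\mathscr{F}=\{X\subseteq\mathbb{N}_n:|X|=r+1, Y\subset X\text{ for some }Y\in\mathscr{F}\}$ and its shadow is $\Delta\mathscr{F}=\{X:|X|=r-1, X\subset Y\text{ for some }Y\in\mathscr{F}\}$. Squashed order on $r$-subsets: $A<_s B$ if $A\ne B$ and the largest element of the symmetric difference of $A$ and $B$ lies in $B$. $F_{n,r}(m)$ (resp. $L_{n,r}(m)$) is the family of the first (resp. last) $m$ $r$-subsets of $\mathbb{N}_n$ in squashed order. Every nonnegative integer $m$ has a unique $r$-binomial representation $m=\sum_{i=t}^{r}\binom{a_i}{i}$ with $a_r>\dots>a_t\ge t\ge1$ (empty for $m=0$). The Kruskal–Katona function is $\kappa_r(m):=\sum_{i=t}^r\binom{a_i}{i-1}-m$ (which equals $|\Delta F_{n,r}(m)|-m$ for $m\le\binom nr$), and $\kappa^*_r(m):=\min_{0\le j\le m}\kappa_r(j)$. *)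

(* Defs.v *)
From mathcomp Require Import all_boot all_order all_algebra.
From mathcomp Require Import zify.

Set Implicit Arguments.
Unset Strict Implicit.
Unset Printing Implicit Defensive.

Import Order.TTheory GRing.Theory Num.Theory.

(* The ground set {1, ..., n} is modelled by 'I_n, with i : 'I_n standing for
   i + 1; only the order of the elements matters. *)

Section Families.
Variable n : nat.
Implicit Types (F : {set {set 'I_n}}) (A B X : {set 'I_n}) (r m : nat).

Definition antichain F : Prop :=
  forall A B, A \in F -> B \in F -> A \subset B -> A = B.

Definition layer r : {set {set 'I_n}} := [set A : {set 'I_n} | #|A| == r].

Definition level F r : {set {set 'I_n}} := F :&: layer r.

(* The shade of a family F of r-subsets. *)
Definition shade r F : {set {set 'I_n}} :=
  [set X : {set 'I_n} in layer r.+1 | [exists Y in F, Y \subset X]].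

Definition symdiff A B : {set 'I_n} := (A :\: B) :|: (B :\: A).

Definition squashed_lt A B : bool :=
  (A != B) &&
  [exists x in symdiff A B,
     [forall y in symdiff A B, (y <= x)%N] && (x \in B)].

Definition squashed_le A B : bool := (A == B) || squashed_lt A B.

Definition squashed_seq r : seq {set 'I_n} :=
  sort squashed_le (enum (layer r)).

Definition squashed_last r m : {set {set 'I_n}} :=
  [set A in drop (size (squashed_seq r) - m) (squashed_seq r)].

End Families.

(* Binomial representations are encoded by the sequence of their upper entries
   in decreasing order of index: s = [:: a_r; a_(r-1); ...; a_t].  Thus
   a_i = s`_(r - i), and t = r - size s + 1, so that t >= 1 says size s <= r
   and a_t >= t says r - size s < last 0 s. *)

Definition is_binrep (r m : nat) (s : seq nat) : bool :=
  [&& size s <= r, sorted gtn s, (s != [::]) ==> (r - size s < last 0 s)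
    & m == \sum_(j < size s) 'C(nth 0 s j, r - j)].

(* Greedy computation of the representation; see binrepP and
   is_binrep_unique below. *)
Fixpoint binrep (r m : nat) : seq nat :=
  if r is r'.+1 then
    if m == 0 then [::] else
    let a := \max_(a < (m + r).+1 | 'C(a, r) <= m) a in
    a :: binrep r' (m - 'C(a, r))
  else [::].

Definition kappa (r m : nat) : int :=
  let s := binrep r m in
  ((\sum_(j < size s) 'C(nth 0 s j, (r - j).-1))%N%:Z - m%:Z)%R.

(* The minimum of kappa r j over 0 <= j <= m. *)
Definition kappa_star (r m : nat) : int :=
  \big[Num.min/kappa r 0]_(j < m.+1) kappa r j.

Lemma is_binrep_nil r m : is_binrep r m [::] = (m == 0).
Proof. by rewrite /is_binrep /= big_ord0. Qed.

Lemma is_binrep_cons r m a s : is_binrep r.+1 m (a :: s) ->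
  [/\ m = 'C(a, r.+1) + (m - 'C(a, r.+1)),
      is_binrep r (m - 'C(a, r.+1)) s, path gtn a s & r < a].
Proof.
case/and4P=> /= les ps lst /eqP; rewrite big_ord_recl /= subn0 => em.
have ps' : sorted gtn s by exact: path_sorted ps.
have le_last (u : seq nat) b : path gtn b u -> last b u + size u <= b.
  elim: u b => [|c u IHu] b /=; first by rewrite addn0.
  by case/andP=> /= cb /IHu; lia.
split=> //.
- by rewrite {2}em addKn.
- rewrite em addKn /is_binrep ps' -ltnS les /=; apply/andP; split.
    by case: s {em les ps ps'} lst => //= b s; rewrite subSS.
  by apply/eqP/eq_bigr => j _; rewrite /bump /= add1n subSS.
- have := le_last _ _ ps; rewrite subSS in lst; lia.
Qed.

Lemma is_binrep_bounds r m a s : is_binrep r.+1 m (a :: s) ->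
  'C(a, r.+1) <= m < 'C(a.+1, r.+1).
Proof.
elim: r m a s => [|r IHr] m a s /is_binrep_cons[em rs ps ra];
  rewrite {1}em leq_addr /= {1}em binS ltn_add2l.
  case: s rs ps => [|b s]; last by case/and4P.
  by rewrite is_binrep_nil bin0 => /eqP->.
case: s rs ps => [|b s rs /= /andP[ba _]].
  by rewrite is_binrep_nil => /eqP->; rewrite bin_gt0 (ltnW ra).
have /andP[_ h] := IHr _ _ _ rs.
exact: leq_trans h (leq_bin2l _ _).
Qed.

Lemma is_binrep_unique r m s1 s2 :
  is_binrep r m s1 -> is_binrep r m s2 -> s1 = s2.
Proof.
elim: r m s1 s2 => [|r IHr] m; first by move=> [|a s1] [|b s2].
have nz a s : is_binrep r.+1 m (a :: s) -> m != 0.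
  move=> rs; have [_ _ _ ra] := is_binrep_cons rs.
  have /andP[h _] := is_binrep_bounds rs; rewrite -lt0n.
  by apply: leq_trans h; rewrite bin_gt0.
move=> [|a s1] [|b s2] r1 r2 //.
- by move: r1 (nz _ _ r2); rewrite is_binrep_nil => ->.
- by move: r2 (nz _ _ r1); rewrite is_binrep_nil => ->.
have /andP[l1 u1] := is_binrep_bounds r1.
have /andP[l2 u2] := is_binrep_bounds r2.
have ab : a = b.
  apply/eqP; rewrite eqn_leq leqNgt [b <= a]leqNgt; apply/andP; split; apply/negP.
    by move=> /(leq_bin2l r.+1) h; have := leq_trans u2 (leq_trans h l1); rewrite ltnn.
  by move=> /(leq_bin2l r.+1) h; have := leq_trans u1 (leq_trans h l2); rewrite ltnn.
subst b; have [_ q1 _ _] := is_binrep_cons r1; have [_ q2 _ _] := is_binrep_cons r2.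
by rewrite (IHr _ _ _ q1 q2).
Qed.

Lemma binrepP r m : (0 < r) || (m == 0) -> is_binrep r m (binrep r m).
Proof.
elim: r m => [|r IHr] m; first by rewrite orFb is_binrep_nil.
move=> _ /=; case: ifPn => [/eqP->|]; first by rewrite is_binrep_nil.
rewrite -lt0n => m_gt0; pose P := fun a : 'I_(m + r.+1).+1 => 'C(a, r.+1) <= m.
have leC0 : 'C((ord0 : 'I_(m + r.+1).+1), r.+1) <= m by [].
set a := \max_(i | _) _.
have leCa : 'C(a, r.+1) <= m.
  by rewrite /a; case: (eq_bigmax_cond (fun i : 'I__ => nat_of_ord i)
    (A := P)) => [|i Pi ->] //; apply/card_gt0P; exists ord0.
have max_a b : b < (m + r.+1).+1 -> 'C(b, r.+1) <= m -> b <= a.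
  move=> ltb leb; exact: (leq_bigmax_cond (P := P)
    (F := fun i : 'I__ => nat_of_ord i) (Ordinal ltb) leb).
have ra : r < a by apply: max_a; rewrite ?binn //; lia.
have big : forall k, k < 'C(k + r.+1, r.+1).
  elim=> [|k IHk]; first by rewrite binn.
  have : 0 < 'C(k + r.+1, r) by rewrite bin_gt0; lia.
  by rewrite addSn binS; lia.
have lta : a < m + r.+1.
  rewrite ltnNge; apply/negP => /(leq_bin2l r.+1) h.
  by have := leq_ltn_trans (leq_trans h leCa) (big m); rewrite ltnn.
have ltm : m < 'C(a.+1, r.+1).
  rewrite ltnNge; apply/negP => h; have : a < a by apply: max_a h.
  by rewrite ltnn.
have ltm' : m - 'C(a, r.+1) < 'C(a, r) by rewrite binS in ltm; lia.
have rs : is_binrep r (m - 'C(a, r.+1)) (binrep r (m - 'C(a, r.+1))).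
  apply: IHr; case: (r) ltm' => //= ; rewrite bin0; lia.
move: (binrep _ _) rs => s rs.
have ps : path gtn a s.
  case: s rs => //= b s rs; have /and4P[_ srt _ _] := rs.
  rewrite [path _ _ _]srt andbT.
  case: (r) ltm' rs => [|r'] ltm' rs; first by case/and4P: rs.
  have /andP[h _] := is_binrep_bounds rs.
  rewrite ltnNge; apply/negP => /(leq_bin2l r'.+1) h'.
  by have := leq_ltn_trans (leq_trans h' h) ltm'; rewrite ltnn.
case/and4P: rs => les _ lst /eqP em; apply/and4P; split=> //=.
  by case: s les lst {em ps} => [|b s] /=; rewrite subSS ?subn0.
rewrite big_ord_recl /= subn0; apply/eqP.
rewrite -[LHS](subnKC leCa) em; congr (_ + _).
Qed.

(* Main.v *)
Require Import Defs.
From mathcomp Require Import all_boot all_order all_algebra all_fingroup.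
From mathcomp Require Import zify.

Set Implicit Arguments.
Unset Strict Implicit.
Unset Printing Implicit Defensive.

Import Order.TTheory GRing.Theory Num.Theory.

(* Pass to complements of the sets of one family to turn disjointness into
   inclusion: the condition only enters through the number, at most k, of
   members of one antichain that are disjoint from some member of the other.
   Levels below the middle h = n/2 are replaced by their shades, which loses
   nothing and strictly enlarges an antichain having such levels; levels above
   h + 1 are lowered in the same way.  If P and Q are the middle levels, this
   leaves |P| + |Q| <= C(n, h) + k and
   |A| + |B| <= 2 C(n, h+1) + (|P| - |shade P|) + (|Q| - |shade Q|).
   The size of the shade is a submodular function of the family, invariant under
   permutations of the ground set, so (P, Q) may be uncrossed repeatedly into
   (P u pi Q, P n pi Q), until one family is empty or the other one is the whole
   layer; the Kruskal-Katona theorem for the remaining family gives the bound.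
   Equality forces (i) and (ii), and comparing P with the last |P| sets in
   squashed order gives (iii). *)

(** * The Kruskal-Katona function *)

(** The sum inside [kappa], kept in [nat]: the size of the shadow of the first [m] sets of size [r]
    in squashed order. *)
Definition KK (r m : nat) : nat :=
  let s := binrep r m in \sum_(j < size s) 'C(nth 0 s j, (r - j).-1).

Lemma KK0n m : KK 0 m = 0.
Proof. by rewrite /KK /= big_ord0. Qed.

Lemma KKn0 r : KK r 0 = 0.
Proof. by rewrite /KK; case: r => [|r] /=; rewrite big_ord0. Qed.

Lemma KK_rec r m : 0 < m -> exists a,
  [/\ r < a, 'C(a, r.+1) <= m, m < 'C(a.+1, r.+1)
    & KK r.+1 m = 'C(a, r) + KK r (m - 'C(a, r.+1))].
Proof.
rewrite lt0n => m0; have := @binrepP r.+1 m isT.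
rewrite /KK /= (negbTE m0); set a := \max_(i | _) _ => ra.
have /andP[l u] := is_binrep_bounds ra.
have [_ _ _ lt_ra] := is_binrep_cons ra.
exists a; split=> //; rewrite big_ord_recl /=; congr (_ + _).
Qed.

Lemma bin_bracket_uniq r m a b : 'C(a, r) <= m -> m < 'C(b.+1, r) -> a <= b.
Proof.
move=> l u; rewrite leqNgt; apply/negP => /(leq_bin2l r) h.
by have := leq_trans u (leq_trans h l); rewrite ltnn.
Qed.

Lemma KK_rec_eq r m a : 0 < m -> 'C(a, r.+1) <= m -> m < 'C(a.+1, r.+1) ->
  KK r.+1 m = 'C(a, r) + KK r (m - 'C(a, r.+1)).
Proof.
move=> /(KK_rec r)[b [_ lb ub ->]] la ua.
suff -> : a = b by [].
by apply/eqP; rewrite eqn_leq; apply/andP; split; apply: (@bin_bracket_uniq r.+1 m).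
Qed.

Lemma KK_bin r a : r < a -> KK r.+1 'C(a, r.+1) = 'C(a, r).
Proof.
move=> ra; rewrite (@KK_rec_eq _ _ a) ?bin_gt0 ?subnn ?KKn0 ?addn0 //.
by rewrite binS -addn1 leq_add2l bin_gt0 ltnW.
Qed.

(* The recursion also holds at the right end [x = 'C(a, r)] of the bracket, and
   at [a = r] provided that [x = 1]. *)
Lemma KK_step r a x : r <= a -> x <= 'C(a, r) -> (r < a) || (0 < x) ->
  KK r.+1 ('C(a, r.+1) + x) = 'C(a, r) + KK r x.
Proof.
move=> ra; rewrite leq_eqVlt => /orP[/eqP-> _|ltx].
  rewrite -binS KK_bin //; case: r ra => [|r] ra; first by rewrite KK0n !bin0.
  by rewrite KK_bin // binS.
move=> h; have ltra : r < a.
  case/orP: h => // x0; rewrite ltn_neqAle ra andbT; apply/eqP => e.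
  by move: ltx; rewrite -e binn; case: (x) x0.
have C0 : 0 < 'C(a, r.+1) by rewrite bin_gt0.
rewrite (@KK_rec_eq _ _ a) ?addKn ?leq_addr //; last by rewrite binS ltn_add2l.
by rewrite addn_gt0 C0.
Qed.

(** Compare the leading entries [a <= b]. If they agree, induction handles the remainders. If
    [a < b], the remainder of [m1] is at most ['C(a, r)], which bounds the left side by
    ['C(a.+1, r)] and hence by ['C(b, r)], the leading term on the right. *)
Lemma KK_mono r m1 m2 : m1 <= m2 -> KK r m1 <= KK r m2.
Proof.
elim: r m1 m2 => [|r IHr] m1 m2 le12; first by rewrite !KK0n.
case: (posnP m1) => [->|m1_gt0]; first by rewrite KKn0.
have [a [ra la ua ->]] := KK_rec r m1_gt0.
have [b [rb lb ub ->]] := KK_rec r (leq_trans m1_gt0 le12).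
have : a <= b by apply: (@bin_bracket_uniq r.+1 m2) => //; apply: leq_trans le12.
rewrite leq_eqVlt => /orP[/eqP<-|ltab].
  by rewrite leq_add2l; apply: IHr; apply: leq_sub2r.
have le1 : KK r (m1 - 'C(a, r.+1)) <= KK r 'C(a, r).
  by apply: IHr; rewrite leq_subLR -binS ltnW.
apply: (leq_trans (n := 'C(a.+1, r))); last first.
  by apply: leq_trans (leq_addr _ _); apply: leq_bin2l.
case: (r) ra le1 => [|s] ra; first by rewrite !KK0n !bin0.
by rewrite (KK_bin (ltnW ra)) => le1; rewrite binS leq_add2l.
Qed.

(* If [m] has the representation [a_r, a_(r-1), ...], then [d] is
   ['C(a_r - 1, r - 1) + 'C(a_(r-1) - 1, r - 2) + ...], Frankl's lower bound for
   the degree of the element towards which a family of size [m] was shifted. *)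
Lemma KK_split r m : exists d,
  [/\ d <= m, KK r m <= d + KK r.-1 d,
      forall y, 0 < m -> m - d < y -> d <= KK r y
    & forall a, r <= a -> m < 'C(a.+1, r) -> d <= 'C(a, r.-1) /\ m - d < 'C(a, r)].
Proof.
elim: r m => [|r IHr] m.
  exists 0; split=> //.
  by move=> a _; rewrite !bin0 => h; split=> //; lia.
case: (posnP m) => [->|m_gt0].
  exists 0; split=> //; first by rewrite KKn0.
  by move=> a ra _; split=> //; rewrite bin_gt0.
have [a [ra la ua Ke]] := KK_rec r m_gt0; move: Ke.
set x := m - _ => Ke; have [d [dx K1 K2 K3]] := IHr x.
case: a => // a in ra la ua x Ke dx K1 K2 K3 *.
have ltx : x < 'C(a.+1, r) by move: ua; rewrite binS; rewrite /x; lia.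
have [d_le xd_lt] := K3 a ra ltx.
have em : m = 'C(a, r.+1) + 'C(a, r) + x by rewrite -binS /x; lia.
(* The leading entry is now [a.+1] and contributes ['C(a, r)]; the old [d] belongs to the remainder
   [x]. The new difference is ['C(a, r.+1) + (x - d)], and the last clause for [x] makes [d] and
   [(x - d).+1] small enough for [KK_step]. *)
exists ('C(a, r) + d); split.
- by rewrite em; lia.
- rewrite Ke /=; case: (posnP r) => [r0|r_gt0].
    by have d0 : d = 0 by [move: ltx; rewrite r0 bin0; lia]; rewrite d0 r0 !KK0n !bin0.
  have := @KK_step r.-1 a d; rewrite prednK // => ->; [|lia|done|lia].
  by have := binS a r.-1; rewrite prednK //; lia.
- move=> y _ lty; apply: leq_trans (KK_mono (m1 := 'C(a, r.+1) + (x - d).+1) _ _).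
    rewrite KK_step //; last by rewrite orbT.
    rewrite leq_add2l; case: (posnP x) => [x0|x_gt0]; first by lia.
    by apply: K2.
  by lia.
- move=> b rb ltm /=.
  have leab : a.+1 <= b by apply: (@bin_bracket_uniq r.+1 m).
  have := leq_bin2l r leab; have := leq_bin2l r.+1 leab.
  have := binS a r; have d_sum : 'C(a, r) + d <= 'C(a.+1, r).
    case: (posnP r) => [r0|r_gt0]; first by move: ltx; rewrite r0 !bin0; lia.
    by have := binS a r.-1; rewrite prednK //; lia.
  by lia.
Qed.

(** * Shifting and the Kruskal-Katona theorem *)

Section Shadow.
Variable T : finType.
Implicit Types (F G : {set {set T}}) (A B Y Z : {set T}) (x y z : T).

Definition shadow F : {set {set T}} :=
  [set Y : {set T} | [exists z, (z \notin Y) && (z |: Y \in F)]].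

Definition link x F : {set {set T}} := [set Y : {set T} | (x \notin Y) && (x |: Y \in F)].
Definition del x F : {set {set T}} := [set Y in F | x \notin Y].

Lemma shadowP F Y : reflect (exists2 z, z \notin Y & z |: Y \in F) (Y \in shadow F).
Proof.
rewrite inE; apply: (iffP existsP) => [[z /andP[]]|[z zY zF]]; first by exists z.
by exists z; rewrite zY.
Qed.

Lemma card_link_del x F : #|F| = #|link x F| + #|del x F|.
Proof.
rewrite -(cardsID [set A : {set T} | x \in A]); congr (_ + _).
  have inj : {in link x F &, injective (fun Y => x |: Y)}.
    move=> Y Z; rewrite !inE => /andP[xY _] /andP[xZ _] e.
    by rewrite -(setU1K xY) e setU1K.
  rewrite -(card_in_imset inj); apply: eq_card => A.
  apply/idP/imsetP=> [|[Y]]; rewrite !inE.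
    by move=> /andP[AF xA]; exists (A :\ x); rewrite ?inE ?eqxx ?setD1K.
  by move=> /andP[_ YF] ->; rewrite YF setU11.
by apply: eq_card => A; rewrite !inE andbC.
Qed.

(** Split the shadow by [x]: its link at [x] contains the shadow of the link of [F], and its members
    avoiding [x] include the link itself. *)
Lemma card_shadow_link x F : #|link x F| + #|shadow (link x F)| <= #|shadow F|.
Proof.
rewrite (card_link_del x (shadow F)) addnC leq_add //; apply: subset_leq_card.
  apply/subsetP=> Y /shadowP[z zY]; rewrite !inE negb_or => /andP[/andP[xz xY] zF].
  rewrite xY; apply/existsP; exists z.
  by rewrite !inE negb_or eq_sym xz zY setUCA.
apply/subsetP=> Y; rewrite !inE => /andP[xY xF].
by rewrite xY andbT; apply/existsP; exists x; rewrite xY.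
Qed.

Definition swap x y A : {set T} := [set z | tperm x y z \in A].

(** The Erdős-Ko-Rado shift replacing [y] by [x]. *)
Definition shift x y F : {set {set T}} :=
  [set (if [&& y \in A, x \notin A & swap x y A \notin F] then swap x y A else A)
     | A : {set T} in F].

Section Swap.
Variables x y : T.
Local Notation sw := (swap x y).

Lemma swapK : involutive sw.
Proof. by move=> A; apply/setP=> z; rewrite !inE tpermK. Qed.

Lemma card_swap A : #|sw A| = #|A|.
Proof.
rewrite -(card_imset A (@perm_inj _ (tperm x y))); apply: eq_card => z.
by rewrite inE -{2}(tpermK x y z) mem_imset //; apply: perm_inj.
Qed.

Lemma swapU1 z A : sw (z |: A) = tperm x y z |: sw A.
Proof.
apply/setP=> t; rewrite !inE; congr (_ || _).
by rewrite -(inj_eq (@perm_inj _ (tperm x y))) tpermK.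
Qed.

Lemma swap_id A : (x \in A) = (y \in A) -> sw A = A.
Proof. by move=> e; apply/setP=> z; rewrite inE; case: tpermP => // ->. Qed.

Lemma card_shift F : #|shift x y F| = #|F|.
Proof.
apply: card_in_imset => A B AF BF.
case: ifP => [/and3P[yA xA sA]|_]; case: ifP => [/and3P[yB xB sB]|_] //.
- by move/(can_inj swapK).
- by move=> e; rewrite e BF in sA.
- by move=> e; rewrite -e AF in sB.
Qed.

Lemma mem_shift F A : A \in shift x y F =
  if (x \in A) && (y \notin A) then (A \in F) || (sw A \in F)
  else if (y \in A) && (x \notin A) then (A \in F) && (sw A \in F) else A \in F.
Proof.
apply/imsetP/idP => [[B BF ->]|].
  have [/and3P[yB xB sB]|] := boolP [&& y \in B, x \notin B & sw B \notin F].
    by rewrite !inE tpermL tpermR yB xB swapK BF orbT.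
  by case: (x \in B); case: (y \in B); rewrite BF //= => /negPn.
case: ifP => [/andP[xA yA] /orP[AF|sF]|].
- by exists A => //; rewrite (negbTE yA).
- case AF : (A \in F); first by exists A => //; rewrite (negbTE yA).
  exists (sw A) => //.
  by rewrite !inE tpermL tpermR xA yA swapK AF.
case: ifP => [/andP[yA xA] _ /andP[AF sF]|h1 h2 AF].
  by exists A => //; rewrite yA xA sF.
exists A => //; case: ifP => // /and3P[yA xA _].
by rewrite yA xA in h1.
Qed.

Lemma shift_or F A : A \in shift x y F -> A \in F \/ sw A \in F.
Proof.
by rewrite mem_shift; case: ifP => _; [move/orP|case: ifP => _; [case/andP|]]; auto.
Qed.

Lemma swap_shadow F z Y : z \notin Y -> sw (z |: Y) \in F -> sw Y \in shadow F.
Proof.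
move=> zY; rewrite swapU1 => h; apply/shadowP; exists (tperm x y z) => //.
by rewrite inE tpermK.
Qed.

(** Since shifting preserves sizes, it cannot enlarge the shadow. The delicate case is [Y]
    containing [y] but not [x]: then [z |: Y] and its swap both lie in [F], so [Y] and its swap both
    lie in the shadow. *)
Lemma shadow_shift F : shadow (shift x y F) \subset shift x y (shadow F).
Proof.
apply/subsetP=> Y /shadowP[z zY zF]; rewrite mem_shift.
have sF := shift_or zF.
have shY : Y \in shadow F \/ sw Y \in shadow F.
  case: sF => [AF|sF]; [left|right; exact: swap_shadow sF].
  by apply/shadowP; exists z.
case: ifP => [_|up]; first exact/orP.
case: ifP => [/andP[yY xY]|down]; last first.
  by case: shY => //; rewrite swap_id //; move: up down; case: (x \in Y); case: (y \in Y).
have both : z |: Y \in F /\ sw (z |: Y) \in F.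
  move: zF; rewrite mem_shift !inE yY (negbTE xY) !orbT andbF /= orbF.
  case: eqVneq => [xz|_] /=; last by move/andP.
  by rewrite swap_id // !inE yY xz eqxx orbT.
rewrite (swap_shadow zY both.2) andbT; apply/shadowP; exists z => //.
by case: both.
Qed.

End Swap.

(** If [z |: Y] is in [F] and avoids [x], stability lets [x] take the place of [z]. *)
Lemma shadow_del_sub x F :
  (forall y A, A \in F -> y \in A -> x \notin A -> swap x y A \in F) ->
  shadow (del x F) \subset link x F.
Proof.
move=> st; apply/subsetP=> Y /shadowP[z zY]; rewrite !inE negb_or.
move=> /andP[zF /andP[xz xY]]; rewrite xY.
have := st z _ zF; rewrite !inE eqxx negb_or xz xY => /(_ isT isT).
by rewrite swapU1 tpermR swap_id // (negbTE xY) (negbTE zY).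
Qed.

(** Among the families of the same size satisfying [P] whose shadow is no larger, one with the most
    members containing [x] is stable: a missing swap would let [shift] increase that number. *)
Lemma exists_stable x (P : pred {set T}) F : (forall y A, P A -> P (swap x y A)) ->
  {in F, forall A, P A} -> exists G,
  [/\ {in G, forall A, P A}, #|G| = #|F|, #|shadow G| <= #|shadow F|
    & forall y A, A \in G -> y \in A -> x \notin A -> swap x y A \in G].
Proof.
move=> Psw PF.
pose Q G := [&& [forall A in G, P A], #|G| == #|F| & #|shadow G| <= #|shadow F|].
pose deg G := #|[set A : {set T} in G | x \in A]|.
have QF : Q F by rewrite /Q eqxx leqnn !andbT; apply/forall_inP.
case: (@arg_maxnP _ F Q deg QF) => G /and3P[/forall_inP PG /eqP cG sG] maxG.
exists G; split=> // y A AG yA xA; case sAG: (swap x y A \in G) => //.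
have QS : Q (shift x y G).
  apply/and3P; split.
  - apply/forall_inP=> B /shift_or[/PG //|/PG /(Psw y)].
    by rewrite swapK.
  - by rewrite card_shift cG.
  - apply: leq_trans sG; rewrite -(card_shift x y (shadow G)).
    exact/subset_leq_card/shadow_shift.
have : deg (shift x y G) <= deg G := maxG _ QS.
rewrite /deg leqNgt => /negP[]; apply: proper_card.
rewrite properE; apply/andP; split; apply/subsetP.
  move=> B; rewrite !inE mem_shift => /andP[BG xB].
  by rewrite xB BG /= andbF !if_same.
move=> /(_ (swap x y A)); rewrite !inE mem_shift sAG !inE tpermL tpermR yA.
by rewrite (negbTE xA) swapK AG => /(_ isT).
Qed.

(** Frankl's proof. For a family stable towards [x], the link and its shadow bound the shadow from
    below, so by [KK_split] a link of size at least [d] suffices. A smaller link would leave more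
    than [#|G| - d] members avoiding [x]; by induction their shadow has at least [d] sets, yet it
    lies in the link. *)
Theorem Kruskal_Katona r F : {in F, forall A, #|A| = r} -> KK r #|F| <= #|shadow F|.
Proof.
elim: r F => [|r IHr] F; first by rewrite KK0n.
have [m] := ubnP #|F|; elim: m F => // m IHm F ltm uF.
case: (posnP #|F|) => [->|F_gt0]; first by rewrite KKn0.
have exE G : 0 < #|G| -> {in G, forall A, #|A| = r.+1} ->
    exists A x, [/\ A \in G & x \in A].
  move=> /card_gt0P[A AG] /(_ A AG) cA.
  have /card_gt0P[x xA] : 0 < #|A| by rewrite cA.
  by exists A, x.
have [_ [x _]] := exE F F_gt0 uF.
have [||G [uG cG shG st]] := @exists_stable x (fun A => #|A| == r.+1) F.
- by move=> y A /=; rewrite card_swap.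
- by move=> A /uF /= ->.
rewrite -cG in ltm F_gt0 *; apply: leq_trans shG.
have {}uG : {in G, forall A, #|A| = r.+1} by move=> A /uG /eqP.
have sub := subset_leq_card (shadow_del_sub st).
have ec := card_link_del x G.
(* This makes [del x G] smaller than [G], as the inner induction requires. With an empty link,
   [del x G] would be nonempty and so would its shadow, which lies in the link. *)
have link_gt0 : 0 < #|link x G|.
  case: (posnP #|link x G|) => // l0.
  have d0 : 0 < #|del x G| by lia.
  have ud : {in del x G, forall A, #|A| = r.+1} by move=> A; rewrite inE => /andP[/uG].
  have [A [y [Ad yA]]] := exE _ d0 ud.
  have : A :\ y \in shadow (del x G).
    by apply/shadowP; exists y; rewrite ?setD11 ?setD1K.
  move=> h; suff : 0 < #|shadow (del x G)| by lia.
  by apply/card_gt0P; exists (A :\ y).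
have K0 : KK r.+1 #|del x G| <= #|link x G|.
  apply: leq_trans sub; apply: IHm; first by lia.
  by move=> A; rewrite inE => /andP[/uG].
have K1 : KK r #|link x G| <= #|shadow (link x G)|.
  apply: IHr => A; rewrite inE => /andP[xA /uG]; rewrite cardsU1 xA /=; lia.
have [d [d_le /= dK dK' _]] := KK_split r.+1 #|G|.
have led : d <= #|link x G|.
  rewrite leqNgt; apply/negP => ltd.
  have lt_del : #|G| - d < #|del x G|. by lia.
  by have := dK' _ F_gt0 lt_del; lia.
apply: leq_trans dK (leq_trans _ (card_shadow_link x G)).
by apply: leq_add => //; apply: leq_trans K1; apply: KK_mono.
Qed.

End Shadow.

(** * Segments of the squashed order *)

Lemma link_shadow_sub (T : finType) (x : T) (F : {set {set T}}) :
  link x (shadow F) \subset shadow (link x F).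
Proof.
apply/subsetP=> Y; rewrite inE => /andP[xY] /shadowP[z].
rewrite !inE negb_or => /andP[zx zY] zF; apply/existsP; exists z.
by rewrite !inE negb_or zY eq_sym zx xY setUCA.
Qed.

Section Squashed.
Variable n : nat.
Implicit Types (F : {set {set 'I_n}}) (A B X Y : {set 'I_n}) (r m a : nat).

(** The number whose binary digits mark [X]; the squashed order compares these numbers, see
    [squashed_ltE]. *)
Definition wt X := \sum_(i in X) 2 ^ i.

Lemma wt_lt a X : {in X, forall i : 'I_n, i < a} -> wt X < 2 ^ a.
Proof.
elim: a X => [|a IHa] X lta.
  by rewrite /wt big_pred0 // => i; apply/negP => /lta.
case: (pickP [pred i in X | i == a :> nat]) => [i /andP[iX /eqP ia]|no].
  rewrite /wt (big_setD1 i) //= ia expnS mul2n -addnn ltn_add2l; apply: IHa => j.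
  rewrite !inE => /andP[ji /lta]; rewrite ltnS leq_eqVlt => /orP[/eqP e|//].
  by case/eqP: ji; apply: val_inj; rewrite /= e.
apply: (leq_trans (n := 2 ^ a)); last by rewrite leq_exp2l.
apply: IHa => j jX; have := lta j jX; rewrite ltnS leq_eqVlt => /orP[e|//].
by have := no j; rewrite /= jX e.
Qed.

Lemma wt_ge X i : i \in X -> 2 ^ i <= wt X.
Proof. by move=> iX; rewrite /wt (big_setD1 i) //= leq_addr. Qed.

Lemma wt_setID X Y : wt X = wt (X :&: Y) + wt (X :\: Y).
Proof. exact: big_setID. Qed.

Lemma squashed_lt_wt X Y : squashed_lt X Y -> wt X < wt Y.
Proof.
case/andP=> _ /existsP[x /and3P[xD /forall_inP max_x xY]].
rewrite (wt_setID X Y) (wt_setID Y X) setIC ltn_add2l.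
have xX : x \notin X.
  by move: xD; rewrite !inE xY /= andbT.
apply: leq_trans (wt_ge (i := x) _); last by rewrite inE xX.
apply: wt_lt => i iD; rewrite ltn_neqAle max_x ?inE; last by move: iD; rewrite inE => ->.
rewrite andbT; apply/eqP => /val_inj ix.
by move: iD; rewrite ix inE xY.
Qed.

Lemma squashed_lt_total X Y : X != Y -> squashed_lt X Y || squashed_lt Y X.
Proof.
move=> neq; have [z zD] : exists z, z \in symdiff X Y.
  apply/set0Pn; apply: contra neq; rewrite setU_eq0 !setD_eq0 => /andP[sXY sYX].
  by rewrite eqEsubset sXY.
case: (arg_maxnP (fun i : 'I_n => nat_of_ord i) zD) => x /= xD max_x.
have {}xD : x \in symdiff X Y by [].
have symC : symdiff Y X = symdiff X Y by rewrite /symdiff setUC.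
rewrite /squashed_lt neq eq_sym neq symC /=.
have mx : [forall y in symdiff X Y, y <= x] by apply/forall_inP=> y; apply: max_x.
case xY : (x \in Y).
  by apply/orP; left; apply/existsP; exists x; rewrite xD mx.
apply/orP; right; apply/existsP; exists x; rewrite xD mx /=.
by move: xD; rewrite !inE xY andbF orbF.
Qed.

Lemma squashed_ltE X Y : squashed_lt X Y = (wt X < wt Y).
Proof.
apply/idP/idP; first exact: squashed_lt_wt.
case: (eqVneq X Y) => [->|/squashed_lt_total /orP[//|/squashed_lt_wt]]; lia.
Qed.

Lemma wt_inj : injective wt.
Proof.
move=> X Y e; apply/eqP; apply: contraT => /squashed_lt_total.
by rewrite !squashed_ltE e ltnn.
Qed.

Lemma squashed_leE X Y : squashed_le X Y = (wt X <= wt Y).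
Proof. by rewrite /squashed_le squashed_ltE -(inj_eq wt_inj) -leq_eqVlt. Qed.

(** The sum does not depend on [X], so complementation reverses the squashed order. *)
Lemma wt_setC X : wt X + wt (~: X) = \sum_(i < n) 2 ^ i.
Proof.
have := wt_setID setT X; rewrite setTI setTD => <-.
by apply: eq_bigl => i; rewrite inE.
Qed.

Lemma card_layer r : #|layer n r| = 'C(n, r).
Proof. by rewrite -[in RHS](card_ord n) card_draws. Qed.

Lemma squashed_last_sub r m : squashed_last n r m \subset layer n r.
Proof.
apply/subsetP=> X; rewrite inE => /mem_drop.
by rewrite mem_sort mem_enum.
Qed.

Lemma card_squashed_last r m : m <= 'C(n, r) -> #|squashed_last n r m| = m.
Proof.
move=> le_m; rewrite cardsE (card_uniqP _); last first.
  by rewrite drop_uniq // sort_uniq enum_uniq.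
by rewrite size_drop size_sort -cardE card_layer subKn.
Qed.

Lemma squashed_last_up r m X Y : X \in squashed_last n r m -> Y \in layer n r ->
  wt X < wt Y -> Y \in squashed_last n r m.
Proof.
rewrite !inE; set s := squashed_seq n r; set k := _ - m => Xd Yr ltXY.
have Ys : Y \in s by rewrite mem_sort mem_enum inE.
have tr : transitive (@squashed_le n).
  by move=> B A C; rewrite !squashed_leE; apply: leq_trans.
have : sorted (@squashed_le n) s.
  by apply: sort_sorted => A B; rewrite !squashed_leE leq_total.
rewrite sorted_pairwise // -{1}(cat_take_drop k s) pairwise_cat => /andP[/allrelP h _].
move: Ys; rewrite -{1}(cat_take_drop k s) mem_cat => /orP[Yt|//].
by have := h _ _ Yt Xd; rewrite squashed_leE leqNgt ltXY.
Qed.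

Definition initial r F := F \subset layer n r /\
  forall X Y, X \in F -> Y \in layer n r -> wt Y < wt X -> Y \in F.

Lemma wt_setU1 (x : 'I_n) X : x \notin X -> wt (x |: X) = 2 ^ x + wt X.
Proof. by move=> xX; rewrite /wt big_setU1. Qed.

Definition below a : {set 'I_n} := [set i : 'I_n | i < a].

Lemma card_below a : a <= n -> #|below a| = a.
Proof.
move=> le_an; rewrite -[RHS](card_ord a).
have inj : injective (widen_ord le_an).
  by move=> i j /(congr1 val) /= /val_inj.
rewrite -(card_imset predT inj); apply: eq_card => i.
rewrite inE; apply/idP/imsetP => [lt|[j _ ->] /=]; last exact: ltn_ord.
by exists (Ordinal lt) => //; apply: val_inj.
Qed.

Lemma card_below_le a : #|below a| <= a.
Proof.
case: (leqP a n) => [/card_below->//|/ltnW]; apply: leq_trans.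
by apply: leq_trans (max_card _) _; rewrite card_ord.
Qed.

Lemma sub_belowP a X : reflect {in X, forall i : 'I_n, i < a} (X \subset below a).
Proof. by apply: (iffP subsetP) => h i /h; rewrite inE. Qed.

Lemma wt_below a X : (X \subset below a) = (wt X < 2 ^ a).
Proof.
apply/sub_belowP/idP => [/wt_lt //|lt i /wt_ge le].
by rewrite -(ltn_exp2l _ _ (isT : 1 < 2)); apply: leq_ltn_trans lt.
Qed.

Definition draws r a : {set {set 'I_n}} :=
  [set X : {set 'I_n} | X \subset below a & #|X| == r].

Lemma card_draws_le r a : #|draws r a| <= 'C(a, r).
Proof. by rewrite /draws cards_draws leq_bin2l // card_below_le. Qed.

Lemma card_draws_eq r a : a <= n -> #|draws r a| = 'C(a, r).
Proof. by move=> an; rewrite /draws cards_draws card_below. Qed.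

(** With leading entry [a], [F] consists of all sets of its size inside [below a] and of sets
    [x |: Y], where [x] has value [a] and the [Y] form an initial segment one level down. The shadow
    splits accordingly, and induction applies to the link. *)
Lemma initial_shadow r F : initial r F -> #|shadow F| <= KK r #|F|.
Proof.
elim: r F => [|r IHr] F [/subsetP uF iF].
  rewrite KK0n leqn0 cards_eq0 -subset0; apply/subsetP=> Y /shadowP[z _ /uF].
  by rewrite inE cards_eq0 => /eqP/setP/(_ z); rewrite !inE eqxx.
case: (posnP #|F|) => [F0|F_gt0].
  rewrite F0 KKn0 leqn0 cards_eq0 -subset0; apply/subsetP=> Y /shadowP[z _].
  by rewrite (cards0_eq F0) inE.
have [a [ra la ua ->]] := KK_rec r F_gt0.
(* If some [Y] of [draws r.+1 a] were missing, every member of [F] would weigh at most as much as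
   [Y], and [F] would be a proper part of [draws r.+1 a], hence too small. *)
have subF : draws r.+1 a \subset F.
  apply/subsetP=> Y Ya; apply: contraT => YF.
  suff : F \proper draws r.+1 a.
    by move/proper_card; rewrite ltnNge (leq_trans (card_draws_le _ _) la).
  rewrite properE; apply/andP; split; last first.
    by apply/negP=> /subsetP/(_ _ Ya); rewrite (negbTE YF).
  apply/subsetP=> X XF; have := uF _ XF; rewrite !inE => ->; rewrite andbT.
  move: Ya; rewrite inE !wt_below => /andP[wY cY].
  apply: leq_ltn_trans wY; rewrite leqNgt; apply: contra YF => lt.
  by apply: iF lt; rewrite ?inE.
(* A member reaching beyond [a] would outweigh every set of [draws r.+1 a.+1], forcing
   ['C(a.+1, r.+1)] sets into [F]. *)
have Fsub X : X \in F -> X \subset below a.+1.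
  move=> XF; rewrite wt_below ltnNge; apply/negP => ge.
  have [i iX ia] : exists2 i, i \in X & a < i.
    apply/exists_inP; rewrite -[X in is_true X]negbK negb_exists_in.
    apply/negP => /forall_inP h; move: ge; rewrite leqNgt => /negP[].
    by apply: wt_lt => i /h; rewrite -leqNgt.
  have an : a.+1 <= n by apply: leq_trans ia (ltnW (ltn_ord i)).
  move: ua; rewrite ltnNge -(card_draws_eq _ an) => /negP[].
  apply: subset_leq_card; apply/subsetP=> Y; rewrite inE wt_below => /andP[wY cY].
  by apply: iF XF _ _; rewrite ?inE // (leq_trans wY).
have sh_draws Y : Y \in shadow F -> Y \subset below a -> Y \in draws r a.
  move=> /shadowP[z zY /uF]; rewrite !inE cardsU1 zY add1n eqSS => -> ->.
  by [].
(* For [n <= a] no element has value [a], and the leading term alone bounds the shadow. *)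
case: (ltnP a n) => [lt_an|le_na]; last first.
  apply: leq_trans (leq_addr _ _); apply: leq_trans (card_draws_le r a).
  apply: subset_leq_card; apply/subsetP=> Y YF; apply: sh_draws => //.
  by apply/sub_belowP => i _; apply: leq_trans le_na.
set x := Ordinal lt_an.
have below_x X : X \subset below a.+1 -> x \notin X -> X \subset below a.
  move=> /sub_belowP h xX; apply/sub_belowP => i iX; have := h i iX.
  rewrite ltnS leq_eqVlt => /orP[/eqP e|//].
  by case/negP: xX; have -> : x = i by apply: val_inj; rewrite /= e.
have delE : del x F = draws r.+1 a.
  apply/setP=> X; rewrite 2!inE; apply/andP/andP => [[XF xX]|[Xa cX]].
    by split; [apply: below_x (Fsub _ XF) xX|have := uF _ XF; rewrite inE].
  split; first by apply: (subsetP subF); rewrite inE Xa.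
  by apply/negP => /(subsetP Xa); rewrite inE ltnn.
have -> : #|F| - 'C(a, r.+1) = #|link x F|.
  by rewrite (card_link_del x F) delE card_draws_eq ?(ltnW lt_an) // addnK.
rewrite (card_link_del x (shadow F)) addnC leq_add //.
  apply: leq_trans (card_draws_le r a); apply: subset_leq_card.
  apply/subsetP=> Y; rewrite inE => /andP[YF xY]; apply: (sh_draws _ YF).
  apply: below_x xY; case/shadowP: YF => z _ /Fsub; apply: subset_trans.
  exact: subsetUr.
apply: leq_trans (IHr _ _); first exact/subset_leq_card/link_shadow_sub.
split.
  apply/subsetP=> X; rewrite !inE => /andP[xX /uF].
  by rewrite inE cardsU1 xX.
move=> X Y; rewrite inE => /andP[xX XF]; rewrite inE => cY ltw.
have xY : x \notin Y.
  apply/negP => /wt_ge; rewrite leqNgt => /negP[]; apply: ltn_trans ltw _.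
  rewrite -wt_below; apply: below_x xX; apply: subset_trans (Fsub _ XF).
  exact: subsetUr.
rewrite inE xY; apply: iF XF _ _; first by rewrite inE cardsU1 xY.
by rewrite !wt_setU1 // ltn_add2l.
Qed.

(** * Shades as shadows of complements *)

Lemma shadeP r F X : F \subset layer n r ->
  reflect (exists2 z, z \in X & X :\ z \in F) (X \in shade r F).
Proof.
move=> /subsetP uF; rewrite !inE; apply: (iffP andP).
  case=> /eqP cX /existsP[Y /andP[YF sYX]].
  have := uF _ YF; rewrite inE => /eqP cY.
  have /cards1P[z ez] : #|X :\: Y| == 1.
    by have := cardsD X Y; rewrite (setIidPr sYX) cX cY; lia.
  have : z \in X :\: Y by rewrite ez set11.
  rewrite inE => /andP[zY zX]; exists z => //.
  suff -> : X :\ z = Y by [].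
  apply/esym/eqP; rewrite eqEcard subsetD1 sYX zY cY /=.
  by have := cardsD1 z X; rewrite zX cX add1n => -[<-].
case=> z zX zF; have := uF _ zF; rewrite inE => cz.
split; first by rewrite (cardsD1 z X) zX add1n eqSS.
by apply/existsP; exists (X :\ z); rewrite zF subD1set.
Qed.

Definition complF F : {set {set 'I_n}} := [set ~: X | X : {set 'I_n} in F].

Lemma complFK : involutive complF.
Proof.
by move=> F; rewrite /complF -imset_comp (eq_imset _ (@setCK _)) imset_id.
Qed.

Lemma mem_complF F X : (X \in complF F) = (~: X \in F).
Proof. by rewrite -{1}(setCK X) mem_imset //; apply: setC_inj. Qed.

Lemma card_complF F : #|complF F| = #|F|.
Proof. by rewrite card_imset //; apply: setC_inj. Qed.

Lemma complF_layer r F : r <= n -> F \subset layer n r ->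
  complF F \subset layer n (n - r).
Proof.
move=> le_rn /subsetP uF; apply/subsetP=> X; rewrite mem_complF => /uF; rewrite !inE.
by have := cardsC X; rewrite card_ord; lia.
Qed.

Lemma shade_complF r F : F \subset layer n r -> shade r F = complF (shadow (complF F)).
Proof.
move=> uF; apply/setP=> X; rewrite mem_complF.
apply/(shadeP _ uF)/shadowP => [] [z zX zF]; exists z.
- by rewrite inE zX.
- by rewrite mem_complF setCU setCK setIC -setDE.
- by move: zX; rewrite inE negbK.
- by move: zF; rewrite mem_complF setCU setCK setIC -setDE.
Qed.

Lemma card_shade r F : F \subset layer n r -> #|shade r F| = #|shadow (complF F)|.
Proof. by move=> uF; rewrite shade_complF // card_complF. Qed.

Lemma shade_ge_KK r F : r <= n -> F \subset layer n r -> KK (n - r) #|F| <= #|shade r F|.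
Proof.
move=> le_rn uF; rewrite card_shade // -(card_complF F); apply: Kruskal_Katona => X.
by move/(subsetP (complF_layer le_rn uF)); rewrite inE => /eqP.
Qed.

(** The complements of a last segment form an initial segment. Together with [shade_ge_KK] this
    shows that last segments have the smallest shades. *)
Lemma shade_squashed_last r m : r <= n -> m <= 'C(n, r) ->
  #|shade r (squashed_last n r m)| <= KK (n - r) m.
Proof.
move=> le_rn le_m; have uL := squashed_last_sub r m.
rewrite card_shade // -{2}(card_squashed_last le_m) -(card_complF (squashed_last _ _ _)).
apply: initial_shadow; split; first exact: complF_layer.
move=> X Y; rewrite !mem_complF => XL Yr ltw; apply: squashed_last_up XL _ _.
  by move: Yr; rewrite !inE; have := cardsC Y; rewrite card_ord; lia.
by have := wt_setC X; have := wt_setC Y; lia.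
Qed.

End Squashed.

(** * Uncrossing two families *)

Section Core.
Variable n : nat.
Implicit Types (F P Q S : {set {set 'I_n}}) (X Y Z : {set 'I_n}) (s : {perm 'I_n}).

Definition permF s F : {set {set 'I_n}} := [set s @: X | X : {set 'I_n} in F].

Lemma card_permF s F : #|permF s F| = #|F|.
Proof. by rewrite card_imset //; apply/imset_inj/perm_inj. Qed.

Lemma permF_layer r s F : F \subset layer n r -> permF s F \subset layer n r.
Proof.
move=> /subsetP uF; apply/subsetP=> _ /imsetP[X /uF + ->]; rewrite !inE.
by rewrite card_imset //; apply: perm_inj.
Qed.

Lemma card_shade_permF r s F : #|shade r (permF s F)| <= #|shade r F|.
Proof.
rewrite -(card_permF s (shade r F)); apply/subset_leq_card/subsetP=> X.
rewrite !inE => /andP[cX /existsP[_ /andP[/imsetP[Z ZF ->] sZX]]].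
have eX : X = s @: (s @^-1: X).
  apply/setP=> x; apply/idP/imsetP=> [xX|[y]]; last by rewrite inE => ? ->.
  by exists (s^-1%g x); rewrite ?inE permKV.
rewrite eX; apply: imset_f; rewrite !inE.
rewrite -(card_imset _ (@perm_inj _ s)) -eX cX; apply/existsP; exists Z.
by rewrite ZF sub_imset_pre in sZX *.
Qed.

(** The indicator tuples of [X] and [Y] have equally many entries of each value, so one is a
    rearrangement of the other. *)
Lemma perm_sets_trans X Y : #|X| = #|Y| -> exists s, s @: X = Y.
Proof.
move=> cXY; pose bt Z := [tuple (i \in Z) | i < n].
have cnt b Z : count_mem b (bt Z) = if b then #|Z| else n - #|Z|.
  rewrite count_map -sum1_count big_enum_cond /= sum1_card.
  case: b; first by apply: eq_card => i; rewrite unfold_in addbT negbK.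
  have := cardsC Z; rewrite card_ord => e; rewrite -[X in X - _]e addKn.
  apply: eq_card => i.
  by rewrite inE unfold_in addbF.
have : perm_eq (bt X) (bt Y) by apply/allP => b _ /=; rewrite !cnt cXY.
case/tuple_permP => s /val_inj es; exists s; have mem j : (j \in X) = (s j \in Y).
  by have := congr1 (fun t => tnth t j) es; rewrite !tnth_mktuple.
apply/setP=> i; apply/imsetP/idP => [[j + ->]|iY]; first by rewrite mem.
by exists ((s^-1)%g i); rewrite ?mem permKV.
Qed.

(** The shade of a union is covered by the two shades, and the shade of an intersection lies in
    both. *)
Lemma shade_submod r P Q :
  #|shade r (P :|: Q)| + #|shade r (P :&: Q)| <= #|shade r P| + #|shade r Q|.
Proof.
rewrite -[leqRHS]cardsUI; apply: leq_add; apply/subset_leq_card/subsetP=> X; rewrite !inE.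
  case/andP=> -> /existsP[Y /andP[]]; rewrite inE => /orP[] YF sYX; apply/orP.
    by left; apply/existsP; exists Y; rewrite YF.
  by right; apply/existsP; exists Y; rewrite YF.
case/andP=> -> /existsP[Y /andP[]]; rewrite inE => /andP[YP YQ] sYX.
by apply/andP; split; apply/existsP; exists Y; rewrite ?YP ?YQ.
Qed.

(* Some permutation takes a member of [Q] outside [P], so that uncrossing makes
   [Q] smaller, unless [Q] is empty or [P] is the whole layer. *)
Lemma uncross r P Q : P \subset layer n r -> Q \subset layer n r ->
  exists P' Q', [/\ P' \subset layer n r, Q' \subset layer n r,
    #|P'| + #|Q'| = #|P| + #|Q|,
    #|shade r P'| + #|shade r Q'| <= #|shade r P| + #|shade r Q|
    & Q' = set0 \/ P' = layer n r].
Proof.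
have [m] := ubnP #|Q|; elim: m P Q => // m IHm P Q ltm uP uQ.
have [->|/set0Pn[X XQ]] := eqVneq Q set0.
  by exists P, set0; split; rewrite ?sub0set //; left.
have [->|neP] := eqVneq P (layer n r).
  by exists (layer n r), Q; split => //; right.
have /subsetPn[Y Yr YP] : ~~ (layer n r \subset P).
  by apply: contra neP => h; rewrite eqEsubset uP.
have [s sXY] : exists s, s @: X = Y.
  apply: perm_sets_trans; move: Yr (subsetP uQ _ XQ).
  by rewrite !inE => /eqP-> /eqP->.
have uQ' := permF_layer s uQ.
have YQ' : Y \in permF s Q by rewrite -sXY imset_f.
have lt_int : #|P :&: permF s Q| < #|Q|.
  rewrite -(card_permF s Q); apply: proper_card.
  rewrite properE subsetIr; apply/subsetPn; exists Y => //.
  by rewrite inE (negbTE YP).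
have [|||P' [Q' [uP' uQ'' cs ss h]]] := IHm (P :|: permF s Q) (P :&: permF s Q).
- by lia.
- by rewrite subUset uP.
- by apply: subset_trans uP; apply: subsetIl.
exists P', Q'; split=> //; first by rewrite cs cardsUI card_permF.
apply: leq_trans ss (leq_trans (shade_submod _ _ _) _).
by rewrite leq_add2l card_shade_permF.
Qed.

(** Count pairs of an element and a set: for each [x], adding [x] injects the members of [F]
    avoiding [x] into the members of the shade containing [x]. *)
Lemma local_LYM r F : F \subset layer n r -> (n - r) * #|F| <= r.+1 * #|shade r F|.
Proof.
move=> uF; have uF' := subsetP uF.
have -> : (n - r) * #|F| = \sum_(x : 'I_n) #|[set Y in F | x \notin Y]|.
  under eq_bigr => x _ do rewrite -sum1dep_card.
  rewrite (exchange_big_dep (mem F)) /=; last by move=> x Y _; case/andP.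
  rewrite mulnC -sum_nat_const; apply: eq_bigr => Y YF.
  rewrite sum1dep_card; have := uF' _ YF; rewrite inE => /eqP <-.
  have := cardsC Y; rewrite card_ord => e; rewrite -[X in X - _]e addKn.
  by apply: eq_card => x; rewrite !inE YF.
have -> : r.+1 * #|shade r F| = \sum_(x : 'I_n) #|[set X in shade r F | x \in X]|.
  under eq_bigr => x _ do rewrite -sum1dep_card.
  rewrite (exchange_big_dep (mem (shade r F))) /=; last by move=> x Y _; case/andP.
  rewrite mulnC -sum_nat_const; apply: eq_bigr => Y YF.
  rewrite sum1dep_card; have : #|Y| = r.+1.
    by apply/eqP; move: YF; rewrite !inE => /andP[].
  by move=> <-; apply: eq_card => x; rewrite [RHS]inE YF.
apply: leq_sum => x _.
have inj : {in [set Y in F | x \notin Y] &, injective (fun Y => x |: Y)}.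
  move=> Y Z; rewrite !inE => /andP[_ xY] /andP[_ xZ] e.
  by rewrite -(setU1K xY) e setU1K.
rewrite -(card_in_imset inj); apply/subset_leq_card/subsetP=> _ /imsetP[Y + ->].
rewrite inE => /andP[YF xY]; rewrite inE setU11 andbT.
by apply/(shadeP _ uF); exists x; rewrite ?setU11 ?setU1K.
Qed.

Lemma shade_gt r F : r + r.+1 < n -> F \subset layer n r -> F != set0 ->
  #|F| < #|shade r F|.
Proof. by rewrite -card_gt0 => lt_rn /local_LYM; nia. Qed.

Lemma shadow_ge r F : n.+1 < r + r -> r <= n ->
  F \subset layer n r -> #|F| <= #|shadow F|.
Proof.
move=> lt_nr le_rn uF; have [->|nF] := eqVneq F set0; first by rewrite cards0.
have uF' := complF_layer le_rn uF.
rewrite -(complFK F) -(card_shade uF') card_complF ltnW // shade_gt //; first by lia.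
by rewrite -card_gt0 card_complF card_gt0.
Qed.

Lemma shade_layer r : r < n -> shade r (layer n r) = layer n r.+1.
Proof.
move=> lt_rn; apply/setP=> X; apply/(shadeP _ (subxx _))/idP.
  by case=> z zX; rewrite !inE (cardsD1 z X) zX add1n eqSS.
rewrite inE => /eqP cX; have /card_gt0P[z zX] : 0 < #|X| by rewrite cX.
by exists z => //; rewrite inE; move: cX; rewrite (cardsD1 z X) zX add1n => -[->].
Qed.

(** Let [S] be the part of layer [r.+1] outside the shade. Its shadow avoids [F] and is at least as
    large as [S]. *)
Lemma card_layer_shade r F : n = r.*2 -> 0 < r -> F \subset layer n r ->
  #|F| + 'C(n, r.+1) <= 'C(n, r) + #|shade r F|.
Proof.
move=> en r_gt0 uF; pose S := layer n r.+1 :\: shade r F.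
have uS : S \subset layer n r.+1 by apply: subsetDl.
have uSF : shade r F \subset layer n r.+1.
  by apply/subsetP=> X; rewrite !inE => /andP[].
have cS : #|S| = 'C(n, r.+1) - #|shade r F|.
  by rewrite cardsD card_layer (setIidPr uSF).
have leS : #|S| <= #|shadow S| by apply: (@shadow_ge r.+1) => //; lia.
have : #|shadow S| <= #|layer n r :\: F|.
  apply/subset_leq_card/subsetP=> Y /shadowP[z zY zS].
  move: (subsetP uS _ zS); rewrite !inE cardsU1 zY add1n eqSS => ->; rewrite andbT.
  apply: contraL zS => YF; rewrite inE negb_and negbK; apply/orP; left.
  by apply/(shadeP _ uF); exists z; rewrite ?setU11 ?setU1K.
rewrite cardsD card_layer (setIidPr uF).
have := subset_leq_card uF; rewrite card_layer.
by have := subset_leq_card uSF; rewrite card_layer; lia.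
Qed.

(** * The bound for two families in the middle layer *)

Local Open Scope ring_scope.

Lemma kappaE r m : kappa r m = (KK r m)%:Z - m%:Z.
Proof. by []. Qed.

Lemma kappa_star_le r k j : (j <= k)%N -> kappa_star r k <= kappa r j.
Proof.
rewrite -ltnS => lt_jk; rewrite /kappa_star.
exact: (@bigmin_le_cond _ _ _ _ (Ordinal lt_jk) xpredT (fun j : 'I_k.+1 => kappa r j)).
Qed.

(** After uncrossing, either [Q'] is empty, where [kappa_star h k <= kappa h 0 = 0] is enough, or
    [P'] is the whole layer. Then [#|Q'| <= k], and the shade of [Q'] exceeds [Q'] by at least
    [kappa h #|Q'|]. *)
Lemma two_shades_bound h P Q k : n = h.*2 -> (0 < h)%N ->
  P \subset layer n h -> Q \subset layer n h -> (#|P| + #|Q| <= 'C(n, h) + k)%N ->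
  (#|P| + #|Q| + 'C(n, h.+1))%N%:Z + kappa_star h k <=
  ('C(n, h) + (#|shade h P| + #|shade h Q|))%N%:Z.
Proof.
move=> en h_gt0 uP uQ le_k.
have [P' [Q' [uP' uQ' cs ss h0]]] := uncross uP uQ.
rewrite -cs in le_k *; case: h0 => [Q0|Pl].
- have := kappa_star_le h (leq0n k); rewrite kappaE KKn0 subrr Q0 cards0 addn0.
  have := card_layer_shade en h_gt0 uP'; lia.
- have le_hn : (h <= n)%N by lia.
  have cP : #|P'| = 'C(n, h) by rewrite Pl card_layer.
  have sP : #|shade h P'| = 'C(n, h.+1) by rewrite Pl shade_layer ?card_layer //; lia.
  have le_Q : (#|Q'| <= k)%N by lia.
  have := kappa_star_le h le_Q; have := shade_ge_KK le_hn uQ'.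
  rewrite kappaE (_ : n - h = h)%N; last by lia.
  by lia.
Qed.

End Core.

(** * Antichains *)

Lemma exists_between (T : finType) (S0 S : {set T}) m :
  S0 \subset S -> #|S0| <= m <= #|S| ->
  exists G : {set T}, [/\ S0 \subset G, G \subset S & #|G| = m].
Proof.
move=> sS /andP[]; elim: m => [|m IHm] le0 leS.
  by exists S0; split=> //; lia.
move: le0; rewrite leq_eqVlt => /orP[/eqP e|]; first by exists S0; split.
rewrite ltnS => /IHm/(_ (ltnW leS))[G [s0G sGS cG]].
have /subsetPn[x xS xG] : ~~ (S \subset G).
  by apply: contraL leS => /subset_leq_card; rewrite cG -leqNgt.
exists (x |: G); split; last by rewrite cardsU1 xG cG.
  exact: subset_trans (subsetUr _ _).
by rewrite subUset sub1set xS.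
Qed.

Section Push.
Variable n : nat.
Implicit Types (F G A B : {set {set 'I_n}}) (X Y Z : {set 'I_n}) (r t : nat).

Lemma in_layer r X : (X \in layer n r) = (#|X| == r).
Proof. by rewrite inE. Qed.

Lemma in_level r A X : (X \in level A r) = (X \in A) && (#|X| == r).
Proof. by rewrite !inE. Qed.

Lemma level_sub r A : level A r \subset layer n r.
Proof. exact: subsetIr. Qed.

Lemma card_in_shade r F X : X \in shade r F -> #|X| = r.+1.
Proof. by rewrite !inE => /andP[/eqP]. Qed.

Lemma shade_ex r F X : X \in shade r F -> exists2 Y, Y \in F & Y \subset X.
Proof. by rewrite inE => /andP[_ /exists_inP]. Qed.

(** [G] may be only a part of the shade of the lowest level, as [raise_bad] requires. *)
Definition raise r A G : {set {set 'I_n}} := (A :\: layer n r) :|: G.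

(** A set of [G] contains some [Y] of [A] at level [r]. Any [Z] of [A] above it contains [Y], hence
    equals [Y], so no kept set contains or equals a set of [G]. *)
Lemma raise_antichain r A G : antichain A -> {in A, forall X : {set 'I_n}, r <= #|X|} ->
  G \subset shade r (level A r) ->
  [/\ antichain (raise r A G), {in raise r A G, forall X : {set 'I_n}, r < #|X|}
    & #|raise r A G| + #|level A r| = #|A| + #|G|].
Proof.
move=> acA geA /subsetP sG.
have cG X : X \in G -> #|X| = r.+1 by move/sG/card_in_shade.
have bG X Z : X \in G -> X \subset Z -> Z \in A -> #|Z| = r.
  move=> /sG/shade_ex[Y]; rewrite in_level => /andP[YA /eqP cY] sYX sXZ ZA.
  by rewrite -cY (acA Y Z) //; apply: subset_trans sXZ.
have gt X : X \in A :\: layer n r -> X \in A /\ r < #|X|.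
  by rewrite inE in_layer => /andP[nX XA]; rewrite ltn_neqAle eq_sym nX geA.
have eqc X Z : X \subset Z -> #|Z| <= #|X| -> X = Z.
  by move=> s c; apply/eqP; rewrite eqEcard s.
split.
- move=> X Z /setUP[/gt[XA lX]|XG] /setUP[/gt[ZA lZ]|ZG] sXZ.
  + exact: acA.
  + by apply: eqc => //; rewrite (cG Z).
  + by have := bG _ _ XG sXZ ZA; lia.
  + by apply: eqc => //; rewrite !cG.
- by move=> X /setUP[/gt[]|/cG ->].
- rewrite /raise cardsU -(cardsID (layer n r) A).
  have -> : (A :\: layer n r) :&: G = set0.
    apply/setP=> X; rewrite in_set0 in_setI; apply/negP => /andP[/gt[XA lX] XG].
    by have := bG _ _ XG (subxx _) XA; lia.
  by rewrite cards0 subn0 /level; lia.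
Qed.

Lemma shade_ge r F : r + r.+1 < n -> F \subset layer n r -> #|F| <= #|shade r F|.
Proof.
move=> lt_rn uF; have [->|nF] := eqVneq F set0; first by rewrite cards0.
exact/ltnW/shade_gt.
Qed.

(** Below the middle the shade of a nonempty family is strictly larger, which gives the last clause.
    That each new set contains an old one keeps disjointness from a new set inherited by an old
    one. *)
Lemma raise_all t r A : t.*2 <= n -> r <= t -> antichain A ->
  {in A, forall X : {set 'I_n}, r <= #|X|} -> exists A',
  [/\ antichain A', #|A| <= #|A'|,
      {in A', forall X : {set 'I_n}, (t <= #|X|) /\ (X \in A \/ #|X| = t)},
      {in A', forall X, exists2 Y, Y \in A & Y \subset X}
    & #|A'| = #|A| -> {in A, forall X : {set 'I_n}, t <= #|X|}].
Proof.
move=> le_tn; move: {2}(t - r) (erefl (t - r)) => d.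
elim: d r A => [|d IHd] r A e_d le_rt acA geA.
  have {e_d le_rt} e_rt : r = t by lia.
  rewrite e_rt in geA; exists A; split=> // X XA; last by exists X.
  by split; [apply: geA|left].
have [acR gtR cR] := raise_antichain acA geA (subxx _).
have lt_r : r + r.+1 < n by lia.
have le_sh := shade_ge lt_r (level_sub r A).
have [||A' [acA' leA' hA' bA' eqA']] := IHd r.+1 _ _ _ acR gtR; [lia..|].
exists A'; split=> //.
- by lia.
- move=> X /[dup] XA' /hA'[le_t [|]]; last by split=> //; right.
  case/setUP=> [/setDP[]|/card_in_shade cX]; split=> //; first by left.
  by right; lia.
- move=> X /bA'[Y /setUP[/setDP[YA _]|/shade_ex[Z ZU sZY]] sYX]; first by exists Y.
  move: ZU; rewrite in_level => /andP[ZA _]; exists Z => //; exact: subset_trans sYX.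
- move=> eA X XA; have lev0 : level A r = set0.
    by apply/eqP; apply: contraT => /(shade_gt lt_r (level_sub r A)); lia.
  apply: eqA'; first by lia.
  apply/setUP; left; apply/setDP; split=> //.
  have : X \notin level A r by rewrite lev0 inE.
  by rewrite in_level XA in_layer.
Qed.

(* Taking the whole shade of the lowest level could create many bad sets.  Keep
   instead the shade of its good members, which is good and at least as large,
   and add only as many sets as are needed to preserve the size: at most one for
   each bad member. *)
Lemma raise_bad t r B (bad : pred {set 'I_n}) : t.*2 <= n -> r <= t -> antichain B ->
  (forall X Y, X \subset Y -> bad Y -> bad X) ->
  {in B, forall X : {set 'I_n}, r <= #|X|} -> exists B',
  [/\ antichain B', #|B| <= #|B'|, {in B', forall X : {set 'I_n}, t <= #|X|}
    & #|[set X in B' | bad X]| <= #|[set X in B | bad X]|].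
Proof.
move=> le_tn + + mono; move: {2}(t - r) (erefl (t - r)) => d.
elim: d r B => [|d IHd] r B e_d le_rt acB geB.
  by have e_rt : r = t by [lia]; rewrite e_rt in geB; exists B.
have lt_r : r + r.+1 < n by lia.
set U := level B r; pose U1 := [set X in U | bad X]; pose U0 := [set X in U | ~~ bad X].
have cU : #|U| = #|U1| + #|U0|.
  by rewrite -(cardsID [set X | bad X] U); congr (_ + _); apply: eq_card => X;
    rewrite !inE // andbC.
have uU : U \subset layer n r := level_sub r B.
have sU0 : U0 \subset U by apply/subsetP=> X; rewrite inE => /andP[].
have sS : shade r U0 \subset shade r U.
  apply/subsetP=> X; rewrite !inE => /andP[-> /exists_inP[Y YU sYX]].
  by apply/exists_inP; exists Y => //; apply: (subsetP sU0).
have le0 := shade_ge lt_r (subset_trans sU0 uU).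
have leU := shade_ge lt_r uU.
have [|G [s0G sGS cG]] := @exists_between _ _ _ (maxn #|U| #|shade r U0|) sS.
  by rewrite leq_maxr geq_max leU subset_leq_card.
have [acR gtR cR] := raise_antichain acB geB sGS.
have [||B' [acB' leB' geB' badB']] := IHd r.+1 _ _ _ acR gtR; [lia..|].
exists B'; split=> //; first by rewrite -/U in cR; lia.
apply: leq_trans badB' _.
have badS0 X : X \in shade r U0 -> ~~ bad X.
  by case/shade_ex=> Y; rewrite inE => /andP[_ + sYX]; apply/contra/mono.
apply: (leq_trans (n := #|[set X in B :\: layer n r | bad X]| + #|G :\: shade r U0|)).
  apply: leq_trans (leq_card_setU _ _); apply/subset_leq_card/subsetP=> X.
  rewrite inE => /andP[/setUP[XB|XG] bX]; apply/setUP; [left|right].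
    by rewrite inE XB.
  by apply/setDP; split=> //; apply: contraL bX; apply: badS0.
have -> : #|[set X in B | bad X]| = #|[set X in B :\: layer n r | bad X]| + #|U1|.
  rewrite -(cardsID (layer n r) [set X in B | bad X]) addnC; congr (_ + _).
    by apply: eq_card => X; rewrite !inE andbA.
  by apply: eq_card => X; rewrite !inE -!andbA [bad X && _]andbC.
(* The added sets number [maxn #|U| #|shade r U0| - #|shade r U0|], at most [#|U1|] because
   [#|U0| <= #|shade r U0|]. *)
rewrite leq_add2l cardsD (setIidPr s0G) cG; lia.
Qed.

(** The complements of the members above level [h] are raised to level [h.-1]; complementing back
    gives at least as many sets of size [h.+1], all outside the shade of [level A h]. Equality means
    that nothing was raised and that these sets fill the rest of layer [h.+1]. *)
Lemma above_middle h A : n = h.*2 -> 0 < h -> antichain A ->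
  {in A, forall X : {set 'I_n}, h <= #|X|} ->
  #|A| + #|shade h (level A h)| <= #|level A h| + 'C(n, h.+1) /\
  (#|A| + #|shade h (level A h)| = #|level A h| + 'C(n, h.+1) ->
   A = level A h :|: (layer n h.+1 :\: shade h (level A h))).
Proof.
move=> en h_gt0 acA geA; set P := level A h; pose U := A :\: layer n h.
have cA : #|A| = #|P| + #|U| by rewrite -(cardsID (layer n h) A).
have inU X : X \in U -> X \in A /\ h < #|X|.
  by rewrite inE in_layer => /andP[nX XA]; rewrite ltn_neqAle eq_sym nX geA.
have notsh X Z : Z \in U -> X \subset Z -> X \notin shade h P.
  move=> /inU[ZA lZ] sXZ; apply/negP => /shade_ex[Y]; rewrite in_level.
  move=> /andP[YA /eqP cY] sYX; move: lZ.
  by rewrite -(acA Y Z) ?cY ?ltnn //; apply: subset_trans sXZ.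
have cC X : #|~: X| = n - #|X| by rewrite cardsCs setCK card_ord.
have acU : antichain (complF U).
  move=> X Y; rewrite !mem_complF => /inU[XA _] /inU[YA _] sXY.
  by apply: setC_inj; apply/esym/acA => //; rewrite setCS.
have [||W [_ leW hW bW eqW]] := @raise_all h.-1 0 (complF U) _ isT acU => //.
  by lia.
have szU X : X \in complF U -> #|X| <= h.-1.
  by rewrite mem_complF => /inU[_]; rewrite cC; lia.
have sV : complF W \subset layer n h.+1 :\: shade h P.
  apply/subsetP=> X; rewrite mem_complF => XW; rewrite in_setD in_layer.
  have [Y YU sYX] := bW _ XW.
  rewrite (notsh X (~: Y)) -?mem_complF //; last by rewrite -setCS setCK.
  have [ge or] := hW _ XW.
  have le : #|~: X| <= h.-1 by case: or => [/szU|->].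
  by have := cC X; have := max_card X; rewrite card_ord; lia.
have uSh : shade h P \subset layer n h.+1.
  by apply/subsetP=> X /card_in_shade; rewrite in_layer => ->.
have := subset_leq_card sV; have := subset_leq_card uSh.
rewrite cardsD card_layer (setIidPr uSh) card_complF => leSh leV.
rewrite card_complF in leW eqW; split; first by lia.
move=> eA; have eU : #|W| = #|U| by lia.
rewrite -[LHS](setID A (layer n h)); congr (_ :|: _); apply/eqP.
rewrite eqEcard; apply/andP; split; last first.
  by rewrite (cardsD (layer n h.+1)) card_layer (setIidPr uSh) -/U; lia.
apply/subsetP=> X XU; rewrite in_setD (notsh X X) // in_layer eqn_leq.
have [_ ->] := inU _ XU; rewrite andbT.
have : h.-1 <= #|~: X| by apply: eqW => //; rewrite mem_complF setCK.
by rewrite cC; have := max_card X; rewrite card_ord; lia.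
Qed.

(** * Pairs of antichains with few disjoint pairs *)

Definition disjoint_some A X := [exists Y in A, X :&: Y == set0].

Local Open Scope ring_scope.

Lemma pair_bound_above h k A B : n = h.*2 -> (0 < h)%N -> antichain A -> antichain B ->
  {in A, forall X : {set 'I_n}, (h <= #|X|)%N} ->
  {in B, forall X : {set 'I_n}, (h <= #|X|)%N} ->
  (#|[set X in B | disjoint_some A X]| <= k)%N ->
  (#|A| + #|B|)%N%:Z + kappa_star h k <= ('C(n, h) + 'C(n, h.+1))%N%:Z /\
  ((#|A| + #|B|)%N%:Z + kappa_star h k = ('C(n, h) + 'C(n, h.+1))%N%:Z ->
   A = level A h :|: (layer n h.+1 :\: shade h (level A h)) /\
   #|shade h (level A h)| = #|shade h (squashed_last n h #|level A h|)|).
Proof.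
move=> en h_gt0 acA acB geA geB bad_le.
have [leA eqA] := above_middle en h_gt0 acA geA.
have [leB _] := above_middle en h_gt0 acB geB.
set P := level A h in leA eqA *; set Q := level B h in leB *.
have uP : P \subset layer n h := level_sub h A.
have uQ : Q \subset layer n h := level_sub h B.
have le_hn : (h <= n)%N by lia.
have sub_nh : (n - h = h)%N by lia.
have le_PQ : (#|P| + #|Q| <= 'C(n, h) + k)%N.
  (* The complements of [P] again lie in layer [h], and each one belonging to [Q] is a set of [B]
     disjoint from a member of [A]. *)
  rewrite -(card_complF P) -cardsUI -card_layer; apply: leq_add.
    apply: subset_leq_card; rewrite subUset uQ andbT.
    by have := complF_layer le_hn uP; rewrite sub_nh.
  apply: leq_trans bad_le; apply/subset_leq_card/subsetP => X.
  rewrite in_setI mem_complF !in_level => /andP[/andP[XcA _] /andP[XB _]].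
  by rewrite inE XB; apply/exists_inP; exists (~: X); rewrite // setICr.
have bPQ := two_shades_bound en h_gt0 uP uQ le_PQ.
split; first by lia.
move=> e; split; first by apply: eqA; lia.
have leP : (#|P| <= 'C(n, h))%N by rewrite -card_layer subset_leq_card.
have cL := card_squashed_last leP.
(* The same bound holds with the last [#|P|] sets in place of [P]. As it is attained by [P] and [Q],
   the shade of [P] is no larger than that of the last sets; Kruskal-Katona gives the converse. *)
have := two_shades_bound (k := k) en h_gt0 (squashed_last_sub n h #|P|) uQ.
rewrite cL => /(_ le_PQ) bLQ.
have := shade_squashed_last le_hn leP; have := shade_ge_KK le_hn uP.
by lia.
Qed.

(** Both antichains are raised to level [h] without increasing the number of bad sets. The bound for
    the raised pair and the assumed equality leave no room for growth, so [A] had no set below level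
    [h]. *)
Lemma pair_bound h k A B : n = h.*2 -> (0 < h)%N -> antichain A -> antichain B ->
  (#|[set X in B | disjoint_some A X]| <= k)%N ->
  (#|A| + #|B|)%N%:Z + kappa_star h k = ('C(n, h) + 'C(n, h.+1))%N%:Z ->
  {in A, forall X : {set 'I_n}, (h <= #|X|)%N}.
Proof.
move=> en h_gt0 acA acB bad_le e; have le_hn : (h.*2 <= n)%N by lia.
have [A' [acA' leA hA bA eqA]] := @raise_all h 0 A le_hn isT acA (fun _ _ => isT).
have [||B' [acB' leB hB badB]] := @raise_bad h 0 B (disjoint_some A') le_hn isT acB _ _ => //.
  move=> X Y sXY /exists_inP[Z ZA /eqP YZ]; apply/exists_inP; exists Z => //.
  by rewrite -subset0 -YZ setSI.
(* A set disjoint from a member of [A'] is disjoint from the member of [A] inside it. *)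
have bad_le' : (#|[set X in B' | disjoint_some A' X]| <= k)%N.
  apply: leq_trans badB (leq_trans _ bad_le); apply/subset_leq_card/subsetP => X.
  rewrite !inE => /andP[-> /exists_inP[Z /bA[Y YA sYZ] /eqP XZ]].
  by apply/exists_inP; exists Y => //; rewrite -subset0 -XZ setIS.
have geA' : {in A', forall X : {set 'I_n}, (h <= #|X|)%N} by move=> X /hA[].
have [bound _] := pair_bound_above en h_gt0 acA' acB' geA' hB bad_le'.
by apply: eqA; lia.
Qed.

End Push.

(** A member of [B] disjoint from some member of [A] has the same index as its partner, below [k]
    when counting from 0, so it lies in [take k b]. *)
Lemma card_disjoint_some n (A B : {set {set 'I_n}}) k (a b : seq {set 'I_n}) :
  a =i A -> b =i B ->
  (forall i j : nat, i < size a -> j < size b ->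
     nth set0 a i :&: nth set0 b j = set0 -> i = j /\ i < k) ->
  #|[set X in B | disjoint_some A X]| <= k.
Proof.
move=> ea eb hab; apply: (leq_trans (n := size (take k b))); last first.
  by rewrite size_take; case: ltnP => // /ltnW.
apply: leq_trans (card_size _); apply/subset_leq_card/subsetP=> X; rewrite inE.
rewrite -eb => /andP[Xb /exists_inP[Y]]; rewrite -ea => Ya /eqP XY.
have [|||e lt_k] := hab (index Y a) (index X b); rewrite ?index_mem //.
  by rewrite !nth_index // setIC.
rewrite e in lt_k; rewrite -[X in X \in _](nth_index set0 Xb) -(nth_take _ lt_k).
by apply: mem_nth; rewrite size_take; case: ifP => // _; rewrite index_mem.
Qed.

Theorem theorem2p6 (n : nat) (hn : 4 <= n) (hev : ~~ odd n)
  (A B : {set {set 'I_n}}) (hA : antichain A) (hB : antichain B)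
  (k : nat) (hk : k <= minn #|A| #|B|)
  (a b : seq {set 'I_n})
  (ua : uniq a) (ub : uniq b) (ea : a =i A) (eb : b =i B)
  (hdisj : forall i j : nat, i < size a -> j < size b ->
     nth set0 a i :&: nth set0 b j = set0 -> i = j /\ i < k)
  (hcard : ((#|A| + #|B|)%N%:Z =
     ('C(n, n./2) + 'C(n, n./2.+1))%N%:Z - kappa_star n./2 k)%R) :
  forall X : {set {set 'I_n}}, X = A \/ X = B ->
    [/\ X \subset layer n n./2 :|: layer n n./2.+1,
        X = level X n./2 :|:
              (layer n n./2.+1 :\: shade n./2 (level X n./2))
      & #|shade n./2 (level X n./2)| =
        #|shade n./2 (squashed_last n n./2 #|level X n./2|)|].
Proof.
have en : n = n./2.*2 by rewrite even_halfK.
have h_gt0 : 0 < n./2 by lia.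
have hdisj' i j : i < size b -> j < size a ->
    nth set0 b i :&: nth set0 a j = set0 -> i = j /\ i < k.
  by rewrite setIC => ib ja /hdisj[] // ->.
have badB := card_disjoint_some ea eb hdisj.
have badA := card_disjoint_some eb ea hdisj'.
have eAB : ((#|A| + #|B|)%N%:Z + kappa_star n./2 k =
            ('C(n, n./2) + 'C(n, n./2.+1))%N%:Z)%R by rewrite hcard subrK.
have eBA : ((#|B| + #|A|)%N%:Z + kappa_star n./2 k =
            ('C(n, n./2) + 'C(n, n./2.+1))%N%:Z)%R by rewrite addnC.
(* The two bounds describe only their first antichain, so each is applied in both orders. *)
have geA := pair_bound en h_gt0 hA hB badB eAB.
have geB := pair_bound en h_gt0 hB hA badA eBA.
have [_ /(_ eAB)[eA shA]] := pair_bound_above en h_gt0 hA hB geA geB badB.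
have [_ /(_ eBA)[eB shB]] := pair_bound_above en h_gt0 hB hA geB geA badA.
move=> X hX.
suff [eX shX] : X = level X n./2 :|: (layer n n./2.+1 :\: shade n./2 (level X n./2)) /\
    #|shade n./2 (level X n./2)| =
    #|shade n./2 (squashed_last n n./2 #|level X n./2|)|.
  split=> //; rewrite eX; apply: setUSS; first exact: level_sub.
  exact: subsetDl.
by case: hX => ->.
Qed.
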